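(* Suppose that $F:\mathbb{P}\times\mathbb{X}\rightrightarrows\mathbb{Y}$ is $C$-concave on $\mathbb{P}\times\mathbb{X}$. Then the solution mapping $\mathcal{S}:\mathbb{P}\rightrightarrows\mathbb{X}$, $\mathcal{S}(p)=\{x\in\mathbb{X}\ |\ F(p,x)\subseteq C\}$, is a convex set-valued mapping.
   Context: Standing assumptions: $\mathbb{P}$ and $\mathbb{Y}$ are normed vector spaces, $\mathbb{X}$ is a Banach space, $C\subset\mathbb{Y}$ is a closed convex cone with $\mathrm{int}\,C\ne\varnothing$, and $F$ has nonempty values everywhere. A set-valued mapping $\Phi:\mathbb{V}\rightrightarrows\mathbb{Y}$ between normed vector spaces is $C$-concave in $\mathbb{V}$ if $\Phi(tx_1+(1-t)x_2)\subseteq t\Phi(x_1)+(1-t)\Phi(x_2)+C$ for all $x_1,x_2\in\mathbb{V}$ and all $t\in[0,1]$ (here applied with $\mathbb{V}=\mathbb{P}\times\mathbb{X}$). A set-valued mapping $\mathcal{S}:\mathbb{P}\rightrightarrows\mathbb{X}$ is convex if its graph $\{(p,x)\ |\ x\in\mathcal{S}(p)\}$ is a convex set, i.e. $t\mathcal{S}(p_1)+(1-t)\mathcal{S}(p_2)\subseteq\mathcal{S}(tp_1+(1-t)p_2)$ for all $p_1,p_2\in\mathbb{P}$ and $t\in[0,1]$. *)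

(* Defs.v *)
From HB Require Import structures.
From mathcomp Require Import all_boot all_order all_algebra.
From mathcomp Require Import all_classical all_reals all_analysis.

Set Implicit Arguments.
Unset Strict Implicit.
Unset Printing Implicit Defensive.

Import Order.TTheory GRing.Theory Num.Theory.
Import numFieldNormedType.Exports.

Local Open Scope classical_set_scope.
Local Open Scope ring_scope.

(* A set-valued mapping from V to W is a function V -> set W; its values may
   be empty unless the contrary is assumed. *)

Definition set_add (R : realType) (V : normedModType R) (A B : set V) : set V :=
  [set a + b | a in A & b in B].

Definition set_scale (R : realType) (V : normedModType R) (t : R) (A : set V) :
  set V := [set t *: a | a in A].

(* Only positive factors are required; when C is closed and nonempty this
   amounts to stability under all t >= 0, and then 0 belongs to C. *)
Definition cone (R : realType) (V : normedModType R) (C : set V) : Prop :=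
  forall t : R, 0 < t -> set_scale t C `<=` C.

Definition cone_concave (R : realType) (V Y : normedModType R)
    (C : set Y) (Phi : V -> set Y) : Prop :=
  forall (x1 x2 : V) (t : R), 0 <= t <= 1 ->
    Phi (t *: x1 + (1 - t) *: x2) `<=`
      set_add (set_add (set_scale t (Phi x1)) (set_scale (1 - t) (Phi x2))) C.

Definition graph_of (P X : Type) (S : P -> set X) : set (P * X) :=
  [set px | S px.1 px.2].

Definition convex_mapping (R : realType) (P X : normedModType R)
    (S : P -> set X) : Prop :=
  @convex_set R (P * X)%type (graph_of S).

Definition solution_mapping (P X Y : Type) (C : set Y) (F : P * X -> set Y)
    (p : P) : set X :=
  [set x | F (p, x) `<=` C].

(* Main.v *)
Require Import Defs.
From HB Require Import structures.
From mathcomp Require Import all_boot all_order all_algebra.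
From mathcomp Require Import all_classical all_reals all_analysis.

Import Order.TTheory GRing.Theory Num.Theory.
Import numFieldNormedType.Exports.

Local Open Scope classical_set_scope.
Local Open Scope ring_scope.

(** Let [x1] be a solution at [p1], [x2] one at [p2], and [0 <= t <= 1].
    Concavity puts each value of [F] at the convex combination of [(p1, x1)] and
    [(p2, x2)] in [t F(p1, x1) + (1 - t) F(p2, x2) + C].  Since [F(p1, x1)] and
    [F(p2, x2)] lie in [C], this set lies in [(t C + (1 - t) C) + C], which is
    contained in [C + C] by convexity of [C] and then in [C] because a convex
    cone is stable under sums ([cone_addr_closed]). *)

Lemma convex_combination_in (R : realType) (V : normedModType R) (C : set V)
    (t : {i01 R}) (a b : V) :
  @convex_set R V C -> C a -> C b -> C (t%:num *: a + (1 - t%:num) *: b).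
Proof.
by move=> convC Ca Cb; have := convC a b t; rewrite !inE; apply.
Qed.

(** The sum of two points is twice their midpoint: convexity gives the midpoint,
    and the cone property the factor two. *)
Lemma cone_addr_closed (R : realType) (V : normedModType R) (C : set V)
    (a b : V) :
  @convex_set R V C -> cone C -> C a -> C b -> C (a + b).
Proof.
move=> convC coneC Ca Cb.
have half01 : 0 <= (2^-1 : R) <= 1.
  by rewrite invr_ge0 ler0n /= invf_le1 ?ltr0n ?ler1n.
have := @convex_combination_in R V C (Itv01 (andP half01).1 (andP half01).2).
move=> /(_ a b convC Ca Cb) /= Cmid.
have half_compl : 1 - 2^-1 = 2^-1 :> R.
  by rewrite [X in X - _](splitr 1) div1r addrK.
apply: (coneC 2); first by rewrite ltr0n.
exists (2^-1 *: a + (1 - 2^-1) *: b) => //.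
by rewrite half_compl -scalerDr scalerA divff ?pnatr_eq0// scale1r.
Qed.

Theorem proposition4p6 (R : realType) (P Y : normedModType R)
    (X : completeNormedModType R) (C : set Y) (F : P * X -> set Y)
    (C_closed : closed C) (C_convex : @convex_set R Y C) (C_cone : cone C)
    (C_int : interior C !=set0)
    (F_nonempty : forall z : P * X, F z !=set0)
    (F_concave : @cone_concave R (P * X)%type Y C F) :
  @convex_mapping R P X (solution_mapping C F).
Proof.
move=> [p1 x1] [p2 x2] t; rewrite !inE => /= S1 S2.
rewrite /graph_of /solution_mapping /= => y.
have t01 : 0 <= t%:num <= 1 by apply/andP; split.
move=> /(F_concave (p1, x1) (p2, x2) _ t01).
move=> [_ [_ [a Fa <-] [_ [b Fb <-] <-]] [c Cc <-]].
apply: cone_addr_closed => //.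
by apply: convex_combination_in => //; [exact: S1|exact: S2].
Qed.
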